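(* The sequence $\{m_i\}_{i=1,2,\dots}$ is strictly monotone decreasing, i.e. $m_{i+1}<m_i$ for every positive integer $i$.
   Context: A real polynomial is called hyperbolic if all its roots are real. For $n\ge 1$ let $\Delta_n$ be the set of polynomials $p(x)=1+a_1x+\dots+a_nx^n$ with $a_1,\dots,a_n>0$ that are section-hyperbolic, i.e. for every $i=1,\dots,n$ the section (truncation) $1+a_1x+\dots+a_ix^i$ is hyperbolic. Put $a_0=1$ and $\Delta=\bigcup_{n\ge1}\Delta_n$. For a positive integer $i$ set $m_i=\inf_{p\in\Delta} \frac{a_i^2}{a_{i-1}a_{i+1}}$, where the infimum is over those $p\in\Delta$ of degree at least $i+1$ and $a_j$ denotes the coefficient of $x^j$ in $p$. *)

(* Defs.v *)
From mathcomp Require Import all_boot all_order all_algebra.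
From mathcomp Require Import classical_sets reals.
From mathcomp Require Import complex.
Set Implicit Arguments.
Unset Strict Implicit.
Unset Printing Implicit Defensive.
Import Order.TTheory GRing.Theory Num.Theory.
Local Open Scope classical_set_scope.
Local Open Scope ring_scope.

(* "All roots are real" refers to the complex roots, so [p] is mapped to R[i]. *)
Definition hyperbolic (R : realType) (p : {poly R}) : Prop :=
  forall z : R[i], root (map_poly (real_complex R) p) z -> complex.Im z = 0.

Definition section_hyperbolic (R : realType) (n : nat) (p : {poly R}) : Prop :=
  forall k : nat, (1 <= k <= n)%N -> hyperbolic (take_poly k.+1 p).

(* The bound [size p <= n.+1] says that [p] has degree at most [n]; the degree
   is then exactly [n] since the coefficient of 'X^n is positive. *)
Definition Delta_ (R : realType) (n : nat) : set {poly R} :=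
  [set p : {poly R} | [/\ (size p <= n.+1)%N, p`_0 = 1,
                        forall k : nat, (1 <= k <= n)%N -> 0 < p`_k
                      & section_hyperbolic n p]].

Definition Delta (R : realType) : set {poly R} :=
  \bigcup_(n in [set n : nat | (1 <= n)%N]) @Delta_ R n.

(* [(i.+1 < size p)%N] means that [p] has degree at least [i + 1].  For [1 <= i]
   the set below is nonempty and bounded below by 0, so [inf] is its genuine
   greatest lower bound, not a default value. *)
Definition m (R : realType) (i : nat) : R :=
  inf [set p`_i ^+ 2 / (p`_i.-1 * p`_i.+1)
      | p in [set p : {poly R} | Delta p /\ (i.+1 < size p)%N]].

(* Main.v *)
Require Import Defs.
From mathcomp Require Import all_boot all_order all_algebra.
From mathcomp Require Import boolp classical_sets reals topology normedtype derive.
From mathcomp Require Import complex polyrcf.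
From mathcomp Require Import ring lra zify.
Import Order.TTheory GRing.Theory Num.Theory numFieldNormedType.Exports.
Local Open Scope ring_scope.

(** Let [p_k] be the section of degree [k] of [p = \sum_j a_j X^j], with positive
    coefficients, and put [N_k(x) = (-1)^k p_k(-x)], so that
    [N_{k+1}(x) = a_{k+1} x^(k+1) - N_k(x)] and the roots of the [N_k] are positive.

    Section-hyperbolicity has a simple certificate: points [u_1 <= u_2 <= ...] such that
    [N_k(u_k) <= 0] and [a_{k+1} u_k <= a_k].  By the recursion the signs of
    [N_k, N_{k+1}, ...] at [u_k] then alternate, so that [N_k] changes sign along
    [u_1, ..., u_k] and has [k] real roots (lemma [chain_hyperbolic]).  Conversely, if all
    the sections are hyperbolic, then [N_{k+1}(x) < a_{k+1} x^(k+1)] from the second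
    largest root [w_{k+1}] of [N_{k+1}] on, so that [w_{k+1}] exceeds the largest root of
    [N_k]; the largest roots form a certificate, and so do, from degree [2] on, the second
    largest ones.

    The strict decrease comes from the following construction (lemma [improvement]).  For
    small positive [eps], let [q] be [X p_{i+1} + eps p_i'].  Its coefficients of degrees
    [i], [i+1] and [i+2] are [a_{i-1}], [a_i] and [a_{i+1}], so that its ratio of index
    [i+1] is the ratio of index [i] of [p].  The section of degree [k+1] of [q] is
    [X p_k + eps p_{k+2}'] for [k <= i-2], and at the point [w_k] the first term vanishes
    while the second one has the sign required of a certificate, because
    [p_{k+2}' = p_k' + (k+1) a_{k+1} X^k + (k+2) a_{k+2} X^(k+1)] and [N_k'(w_k) <= 0].
    The sections of degrees [i], [i+1] and [i+2] behave similarly, and for the last one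
    the inequality is strict: the coefficient of degree [i+2] can be increased, which
    strictly decreases the ratio of index [i+1].

    This gives [m_{i+1} <= m_i] at once, and [m_{i+1} < m_i] if the infimum [m_i] is
    attained.  In terms of the inverse ratios [a_{k-1} a_{k+1} / a_k^2], and after
    rescaling the points, certificates form a compact set once inverse ratios equal to
    [0] are allowed, hence the inverse ratio of index [i] has a maximum (lemma
    [nchains_max]).  If some inverse ratios vanish there, the coefficients beyond the last
    of them form a section-hyperbolic polynomial by themselves (lemma [nsec_shift]),
    whose ratio of some index [i' <= i] is at most [m_i] (lemma [extremal_admissible]).
    The construction applied to it yields [m_{i+1} <= m_{i'+1} < m_i]. *)

(* Goals on indices: the order hypotheses on real numbers are irrelevant to them. *)
Ltac nlia := repeat match goal with
  | H : is_true (Order.le _ _) |- _ => clear H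
  | H : is_true (Order.lt _ _) |- _ => clear H
  end; lia.

(** * Real-rooted polynomials *)

Lemma hyperbolicZ (R : realType) (c : R) (p : {poly R}) :
  c != 0 -> hyperbolic (c *: p) <-> hyperbolic p.
Proof.
move=> c0; have cC0 : real_complex R c != 0 by rewrite fmorph_eq0.
split=> hp z rz; apply: hp; move: rz; rewrite map_polyZ /=; first by rewrite rootZ.
by rewrite rootZ.
Qed.

Lemma hyperbolic_compN (R : realType) (p : {poly R}) :
  hyperbolic p -> hyperbolic (p \Po - 'X).
Proof.
move=> hp z; rewrite map_comp_poly /= rmorphN /= map_polyX /root horner_comp.
rewrite hornerN hornerX => rz.
by have := hp (- z) rz; case: (z) => x y /= /eqP; rewrite oppr_eq0 => /eqP.
Qed.

Lemma hyperbolic_split {R : realType} {p : {poly R}} :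
  p != 0 -> hyperbolic p ->
  exists s : seq R, p = lead_coef p *: \prod_(v <- s) ('X - v%:P).
Proof.
elim/ltn_ind: (size p) {-2}p (erefl (size p)) => n IH q sq q0 hq.
have [n1|n1] := eqVneq n 1%N.
  exists [::]; rewrite big_nil; move/eqP: sq; rewrite n1 => /size_poly1P[c c0 ->].
  by rewrite lead_coefC alg_polyC.
have /closed_rootP[z rz] : size (map_poly (real_complex R) q) != 1%N.
  by rewrite size_map_poly sq.
have imz := hq z rz.
have zE : z = real_complex R (complex.Re z) by case: z imz {rz} => x y /= ->.
have : root q (complex.Re z) by move: rz; rewrite {1}zE fmorph_root.
move=> /factor_theorem[r qE].
have r0 : r != 0 by apply: contraNneq q0 => r0; rewrite qE r0 mul0r.
have [||s rE] := IH (size r) _ r erefl r0.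
- by rewrite -sq qE size_Mmonic ?monicXsubC // size_XsubC addn2.
- move=> y ry; apply: hq; rewrite qE rmorphM /=.
  by rewrite rootM ry.
exists (complex.Re z :: s); rewrite big_cons {1}qE {1}rE mulrC.
by rewrite qE lead_coef_Mmonic ?monicXsubC // -scalerAr.
Qed.

Lemma ler_normc_Im {R : realType} (z : R[i]) :
  real_complex R `|complex.Im z| <= `|z|.
Proof.
rewrite normc_def lecR -sqrtr_sqr ler_wsqrtr //.
by rewrite lerDr sqr_ge0.
Qed.

(** A monic polynomial whose roots are all real is at least [|Im z|] to the
    power of its degree in absolute value at a complex point [z]. *)
Lemma ler_norm_prod_XsubC {R : realType} (s : seq R) (z : R[i]) :
  real_complex R (`|complex.Im z| ^+ size s) <=
  `|(map_poly (real_complex R) (\prod_(v <- s) ('X - v%:P))).[z]|.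
Proof.
elim: s => [|v s IH] /=; first by rewrite big_nil map_polyC hornerC !rmorph1 normr1.
rewrite big_cons rmorphM hornerM normrM exprS rmorphM.
apply: ler_pM => //; rewrite ?lecR ?exprn_ge0 //.
rewrite rmorphB /= map_polyX map_polyC /= hornerXsubC.
have -> : complex.Im z = complex.Im (z - real_complex R v).
  by case: z {IH} => x y /=; rewrite subr0.
by have := ler_normc_Im (z - real_complex R v); rewrite lecR.
Qed.

(** Limits of polynomials with only real roots: it is enough that [p - eps] splits
    for arbitrarily small positive [eps]. *)
Lemma hyperbolic_limit {R : realType} (p : {poly R}) (c : R) (n : nat) :
  0 < c -> 0 < lead_coef p ->
  (forall eps, 0 < eps < c -> exists2 s : seq R, size s = n &
     p - eps%:P = lead_coef p *: \prod_(v <- s) ('X - v%:P)) ->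
  hyperbolic p.
Proof.
move=> c0 lp0 H z rz; apply/eqP; case: eqVneq => // imz.
pose d := lead_coef p * `|complex.Im z| ^+ n.
have d0 : 0 < d by rewrite mulr_gt0 // exprn_gt0 // normr_gt0.
pose eps := Num.min c d / 2.
have m0 : 0 < Num.min c d by rewrite lt_min c0.
have mc : Num.min c d <= c by rewrite ge_min lexx.
have md : Num.min c d <= d by rewrite ge_min lexx orbT.
have [|s ss pE] := H eps; first by rewrite /eps; lra.
have : `|(map_poly (real_complex R) (p - eps%:P)).[z]| = real_complex R eps.
  rewrite rmorphB /= map_polyC /= hornerD hornerN hornerC.
  move/rootP: rz => ->; rewrite sub0r normrN ger0_norm //.
  by rewrite lecR /eps; lra.
rewrite pE map_polyZ /= hornerZ normrM ger0_norm ?lecR ?(ltW lp0) // => eqn.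
have := ler_norm_prod_XsubC s z; rewrite ss => le1.
have : real_complex R d <= real_complex R eps.
  by rewrite -eqn /d rmorphM ler_wpM2l // lecR ltW.
by rewrite lecR /eps; lra.
Qed.

(** A polynomial of degree [k], positive at infinity, which changes sign along
    [u 1 < ... < u k], the sign at [u k] being negative, has [k] distinct real roots. *)
Lemma alternating_split {R : realType} (p : {poly R}) (k : nat) (u : nat -> R) :
  size p = k.+1 -> 0 < lead_coef p ->
  (forall j, (1 <= j < k)%N -> u j < u j.+1) ->
  (forall j, (1 <= j <= k)%N -> 0 < (-1) ^+ (k - j).+1 * p.[u j]) ->
  exists2 s : seq R, size s = k &
    p = lead_coef p *: \prod_(v <- s) ('X - v%:P).
Proof.
move=> sp lp uS sg.
suff [s [ss us rs]] : exists s : seq R, [/\ size s = k, uniq s & all (root p) s].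
  by exists s => //; apply: all_roots_prod_XsubC => //; rewrite ?ss ?uniq_rootsE.
have H j : (j < k)%N -> exists s : seq R,
    [/\ size s = j, uniq s, all (root p) s & {in s, forall x, x < u j.+1}].
  elim: j => [|j IH] jk; first by exists [::].
  have [s [ss us rs ls]] := IH (ltnW jk).
  have ltu : u j.+1 < u j.+2 by apply: uS; rewrite /= jk.
  have [|x] := @poly_ivtoo R p _ _ (ltW ltu).
    have := sg j.+1 (ltnW jk); have := sg j.+2 jk.
    have -> : ((k - j.+1).+1 = (k - j.+2).+2)%N by rewrite -(subnSK jk).
    rewrite !exprS; set e := (-1) ^+ _; rewrite !mulN1r opprK => h1 h2.
    have e2 : e * e = 1 by rewrite -expr2 sqrr_sign.
    have := mulr_gt0 h1 h2.
    by rewrite mulNr mulNr mulrACA e2 mul1r oppr_gt0 mulrC.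
  rewrite in_itv /= => /andP[x1 x2] rx; exists (x :: s); split => /=.
  - by rewrite ss.
  - rewrite us andbT; apply/negP => /ls xl; by have := lt_trans xl x1; rewrite ltxx.
  - by rewrite rx.
  - move=> y; rewrite inE => /orP[/eqP->//|/ls yl]; exact: lt_trans yl ltu.
case: k sp uS sg H => [|k] sp uS sg H; first by exists [::].
have [s [ss us rs ls]] := H k (ltnSn k).
have [b hb] := poly_pinfty_gt_lc lp.
have [||x] := @poly_ivtoo R p (u k.+1) (Num.max b (u k.+1)).
- by rewrite le_max lexx orbT.
- have := sg k.+1; rewrite ltnSn subnn expr1 => /(_ isT).
  have := hb (Num.max b (u k.+1)); rewrite le_max lexx => /(_ isT); nra.
rewrite in_itv /= => /andP[x1 x2] rx; exists (x :: s); split => /=.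
- by rewrite ss.
- rewrite us andbT; apply/negP => /ls xl; by have := lt_trans xl x1; rewrite ltxx.
- by rewrite rx.
Qed.

(** * Alternating sections *)

(** [altsec a k] is [(-1)^k p_k(-X)], where [p_k] is the section of degree [k] of
    [\sum_j a j *: 'X^j]: the sections of a polynomial with positive coefficients,
    with their negative roots turned into positive ones and a positive leading
    coefficient.  Consecutive sections satisfy the recursion used here. *)
Fixpoint altsec {R : realType} (a : nat -> R) (k : nat) : {poly R} :=
  if k is k'.+1 then a k *: 'X^k - altsec a k' else (a 0%N)%:P.

Section AltSec.
Context {R : realType}.
Implicit Types (a u : nat -> R) (p : {poly R}) (k n : nat) (x : R).

Lemma horner_altsecS a k x :
  (altsec a k.+1).[x] = a k.+1 * x ^+ k.+1 - (altsec a k).[x].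
Proof. by rewrite /= hornerD hornerN hornerZ hornerXn. Qed.

Lemma deriv_altsecS a k x :
  (altsec a k.+1)^`().[x] = k.+1%:R * a k.+1 * x ^+ k - (altsec a k)^`().[x].
Proof.
rewrite /= derivB derivZ derivXn hornerD hornerN hornerZ hornerMn hornerXn /=.
by rewrite -mulr_natl mulrCA mulrA.
Qed.

Lemma eq_altsec a b k : (forall j, (j <= k)%N -> a j = b j) -> altsec a k = altsec b k.
Proof.
elim: k => [|k IH] h /=; first by rewrite h.
by rewrite h // IH // => j jk; apply: h; rewrite leqW.
Qed.

Lemma altsec_neg a k x :
  (forall j, (j <= k)%N -> 0 < a j) -> x <= 0 -> 0 < (-1) ^+ k * (altsec a k).[x].
Proof.
move=> a0 x0; elim: k a0 => [|k IH] a0.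
  by rewrite mul1r hornerC a0.
have -> : (-1) ^+ k.+1 * (altsec a k.+1).[x] =
          a k.+1 * (- x) ^+ k.+1 + (-1) ^+ k * (altsec a k).[x].
  by rewrite horner_altsecS (exprNn x) !exprS; ring.
apply: ltr_wpDl; last by rewrite IH // => j jk; rewrite a0 ?leqW.
by rewrite mulr_ge0 ?exprn_ge0 ?oppr_ge0 // ltW ?a0.
Qed.

Lemma size_altsec_le a k : (size (altsec a k) <= k.+1)%N.
Proof.
case: k => [|k]; first exact: size_polyC_leq1.
elim: k => [|k IH].
  rewrite (leq_trans (size_polyD _ _)) // geq_max size_polyN.
  by rewrite (leq_trans (size_scale_leq _ _)) ?size_polyXn // leqW // size_polyC_leq1.
rewrite (leq_trans (size_polyD _ _)) // geq_max size_polyN.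
by rewrite (leq_trans (size_scale_leq _ _)) ?size_polyXn // leqW.
Qed.

Lemma coef_altsec a k : (altsec a k)`_k = a k.
Proof.
case: k => [|k]; first by rewrite coefC.
rewrite coefB coefZ coefXn eqxx mulr1 nth_default ?subr0 //.
exact: size_altsec_le.
Qed.

Lemma coef_altsec_pred a k : (altsec a k.+1)`_k = - a k.
Proof. by rewrite coefB coefZ coefXn ltn_eqF // mulr0 sub0r coef_altsec. Qed.

Lemma size_altsec a k : a k != 0 -> size (altsec a k) = k.+1.
Proof.
move=> ak; apply/eqP; rewrite eqn_leq size_altsec_le ltnNge.
by apply: contra ak => h; rewrite -coef_altsec nth_default.
Qed.

Lemma lead_coef_altsec a k : a k != 0 -> lead_coef (altsec a k) = a k.
Proof. by move=> ak; rewrite lead_coefE size_altsec //= coef_altsec. Qed.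

Lemma take_poly_altsec p k :
  take_poly k.+1 p = (-1) ^+ k *: (altsec (nth 0 p) k \Po - 'X).
Proof.
elim: k => [|k IH].
  rewrite expr0 scale1r comp_polyC; apply/polyP => i.
  by rewrite coef_take_poly coefC; case: i.
have -> : take_poly k.+2 p = take_poly k.+1 p + p`_k.+1 *: 'X^(k.+1).
  apply/polyP => i; rewrite coefD !coef_take_poly coefZ coefXn.
  rewrite ltnS leq_eqVlt; case: eqP => [->|_] /=.
    by rewrite ltnn mulr1 add0r.
  by rewrite mulr0 addr0.
rewrite IH /= comp_polyB comp_polyZ comp_Xn_poly; set q := _ \Po _.
rewrite -(scaleN1r ('X : {poly R})) exprZn !scalerBr !scalerA mulrAC -expr2 sqrr_sign mul1r.
by rewrite (exprS (-1)) mulN1r scaleNr opprK addrC.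
Qed.

Lemma hyperbolic_take_poly p k :
  hyperbolic (take_poly k.+1 p) <-> hyperbolic (altsec (nth 0 p) k).
Proof.
rewrite take_poly_altsec hyperbolicZ ?signr_eq0 //; split; last exact: hyperbolic_compN.
by move/hyperbolic_compN; rewrite -comp_polyA rmorphN /= comp_polyX opprK comp_polyXr.
Qed.

End AltSec.

(** * A certificate of section-hyperbolicity *)

(** Certificate of section-hyperbolicity up to degree [n]: points [u 1 <= ... <= u n]
    at which the successive sections are nonpositive, none of them too large. *)
Definition chain {R : realType} (a u : nat -> R) (n : nat) : Prop :=
  [/\ 0 < u 1%N,
      forall k, (1 <= k < n)%N -> u k <= u k.+1,
      forall k, (1 <= k <= n)%N -> (altsec a k).[u k] <= 0
    & forall k, (1 <= k < n)%N -> a k.+1 * u k <= a k].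

Section Chain.
Context {R : realType} {a u : nat -> R} {n : nat}.
Hypotheses (a_gt0 : forall k, (k <= n)%N -> 0 < a k) (ch : chain a u n).

Lemma chain_le j k : (1 <= j <= k)%N -> (k <= n)%N -> u j <= u k.
Proof.
case/andP=> j1; case: ch => _ uS _ _; elim: k => [|k IH] jk kn; first lia.
move: jk; rewrite leq_eqVlt => /orP[/eqP->//|jk].
by apply: le_trans (IH _ _) (uS _ _); lia.
Qed.

Lemma chain_gt0 k : (1 <= k <= n)%N -> 0 < u k.
Proof. by move=> kn; case: ch => u1 _ _ _; apply: lt_le_trans u1 (chain_le 1 k _ _); lia. Qed.

(** The sign acquired by a section at one of the points alternates from then on. *)
Lemma chain_sign j k : (1 <= j <= k)%N -> (k <= n)%N ->
  if odd (k - j) then a k * u j ^+ k <= (altsec a k).[u j]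
  else (altsec a k).[u j] <= 0.
Proof.
move=> /andP[j1 jk] kn; elim/ltn_ind: k jk kn => k IH jk kn.
case: ch => u1 uS neg acc.
have uj : 0 < u j by apply: chain_gt0; lia.
have [->|] := eqVneq k j; first by rewrite subnn; apply: neg; lia.
case: k IH jk kn => [|k] IH jk kn kj; first lia.
have := IH k (ltnSn _); rewrite -ltnS ltn_neqAle jk eq_sym kj => /(_ isT (ltnW kn)).
have -> : (k.+1 - j = (k - j).+1)%N by lia.
rewrite /= horner_altsecS; case: ifP => od /= le1; last by rewrite lerBrDr gerDl.
have jk' : (j < k)%N by lia.
have uk : a k.+1 * u j <= a k.
  apply: le_trans (acc k _); last lia.
  by rewrite ler_pM2l ?a_gt0 // chain_le //; lia.
rewrite subr_le0 (le_trans _ le1) // exprS mulrA ler_pM2r ?exprn_gt0 //.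
Qed.

Lemma chain_lt k : (1 <= k < n)%N -> u k < u k.+1.
Proof.
move=> kn; case: ch => _ uS neg _; rewrite lt_neqAle uS // andbT.
apply/eqP => ukE; have := neg k.+1; rewrite -ukE => /(_ ltac:(lia)).
have := @chain_sign k k.+1; rewrite subSnn /= => /(_ ltac:(lia) ltac:(lia)) => h1 h2.
have := le_trans h1 h2; rewrite leNgt mulr_gt0 ?a_gt0 ?exprn_gt0 ?chain_gt0 //; lia.
Qed.

Theorem chain_hyperbolic k : (1 <= k <= n)%N -> hyperbolic (altsec a k).
Proof.
move=> /andP[k1 kn]; have ak := a_gt0 _ kn; have ak0 := lt0r_neq0 ak.
have u1 : 0 < u 1%N by case: ch.
apply: (@hyperbolic_limit _ _ (a k * u 1%N ^+ k) k).
- by rewrite mulr_gt0 // exprn_gt0.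
- by rewrite lead_coef_altsec.
move=> eps /andP[e0 e1].
have szE : (size (- eps%:P) < size (altsec a k))%N.
  by rewrite size_polyN size_altsec // (leq_ltn_trans (size_polyC_leq1 _)).
have -> : lead_coef (altsec a k) = lead_coef (altsec a k - eps%:P).
  by rewrite lead_coefDl.
apply: (@alternating_split _ _ k u); first by rewrite size_polyDl // size_altsec.
- by rewrite lead_coefDl // lead_coef_altsec.
- by move=> j jk; apply: chain_lt; lia.
move=> j /andP[j1 jk]; rewrite hornerD hornerN hornerC -signr_odd /=.
have := @chain_sign j k; rewrite j1 jk => /(_ isT kn); case: odd => /= h.
- rewrite expr0 mul1r subr_gt0 (lt_le_trans e1) // (le_trans _ h) //.
  have uj : 0 < u j by apply: chain_gt0; lia.
  have le1 : u 1%N <= u j by apply: chain_le; lia.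
  by rewrite ler_pM2l // lerXn2r // nnegrE ltW.
- by rewrite expr1 mulN1r oppr_gt0 subr_lt0 (le_lt_trans h).
Qed.

End Chain.

(** * The two largest roots of a section *)

Section ProdXsubC.
Context {R : realType}.
Implicit Types (s : seq R) (x : R).

Lemma prod_XsubC_gt0 s x : {in s, forall v, v < x} ->
  0 < (\prod_(v <- s) ('X - v%:P)).[x].
Proof.
move=> sx; rewrite horner_prod big_seq prodr_gt0 // => v vs.
by rewrite hornerXsubC subr_gt0 sx.
Qed.

Lemma prod_XsubC_ge0 s x : {in s, forall v, v <= x} ->
  0 <= (\prod_(v <- s) ('X - v%:P)).[x].
Proof.
move=> sx; rewrite horner_prod big_seq prodr_ge0 // => v vs.
by rewrite hornerXsubC subr_ge0 sx.
Qed.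

Lemma deriv_prod_XsubC_ge0 s x : {in s, forall v, v < x} ->
  0 <= (\prod_(v <- s) ('X - v%:P))^`().[x].
Proof.
elim: s => [|v s IH] sx; first by rewrite big_nil derivC hornerC.
have sx' : {in s, forall v, v < x} by move=> y ys; rewrite sx // inE ys orbT.
rewrite big_cons derivM derivXsubC mul1r hornerD hornerM hornerXsubC.
by rewrite addr_ge0 ?mulr_ge0 ?IH ?subr_ge0 ?ltW ?prod_XsubC_gt0 // sx ?mem_head.
Qed.

Lemma deriv_prod_XsubC_gt0 v s x : {in v :: s, forall y, y < x} ->
  0 < (\prod_(y <- v :: s) ('X - y%:P))^`().[x].
Proof.
move=> sx; have sx' : {in s, forall y, y < x} by move=> y ys; rewrite sx // inE ys orbT.
rewrite big_cons derivM derivXsubC mul1r hornerD hornerM hornerXsubC.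
rewrite ltr_pwDl ?prod_XsubC_gt0 // mulr_ge0 ?deriv_prod_XsubC_ge0 //.
by rewrite subr_ge0 ltW // sx ?mem_head.
Qed.

Lemma prod_XsubC_le_exp s x : {in s, forall v, 0 <= v <= x} ->
  (\prod_(v <- s) ('X - v%:P)).[x] <= x ^+ size s.
Proof.
elim: s => [|v s IH] sx; first by rewrite big_nil hornerC.
have sx' : {in s, forall v, 0 <= v <= x} by move=> y ys; rewrite sx // inE ys orbT.
have /andP[v0 vx] := sx v (mem_head _ _).
rewrite big_cons hornerM hornerXsubC exprS ler_pM ?IH ?subr_ge0 ?gerBl //.
by rewrite prod_XsubC_ge0 // => y /sx' /andP[].
Qed.

End ProdXsubC.

(** The numbers [V] and [w] are the largest and the second largest roots of the
    alternating section [N_k] of degree [k], all of whose roots are real and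
    positive, together with what this says on the values of [N_k] and, through the
    sum of the roots, on the ratio of its top coefficients.  In degree [1] there is no
    second root, and [w] only satisfies [0 < w <= V]. *)
Record top_roots {R : realType} (a : nat -> R) (k : nat) (V w : R) : Prop := TopRoots {
  top_w_gt0 : 0 < w;
  top_w_le : w <= V;
  top_root : (altsec a k).[V] = 0;
  top_gt0 : forall x, V < x -> 0 < (altsec a k).[x];
  top_deriv_gt0 : forall x, V < x -> 0 < (altsec a k)^`().[x];
  top_lb : a k * V <= a k.-1;
  top_ub : a k.-1 <= k%:R * (a k * V);
  top_w_root : (2 <= k)%N -> (altsec a k).[w] = 0;
  top_w_deriv : (2 <= k)%N -> (altsec a k)^`().[w] <= 0;
  top_w_lb : (2 <= k)%N -> 2 * (a k * w) <= a k.-1;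
  top_lt : (2 <= k)%N -> forall x, w <= x -> (altsec a k).[x] < a k * x ^+ k }.

Lemma altsec_top_roots {R : realType} (a : nat -> R) (k : nat) :
  (1 <= k)%N -> (forall j, (j <= k)%N -> 0 < a j) -> hyperbolic (altsec a k) ->
  exists V w, top_roots a k V w.
Proof.
case: k => // k _ a0 hyp; have ak := a0 _ (leqnn _); have ak0 := lt0r_neq0 ak.
have N0 : altsec a k.+1 != 0 by rewrite -size_poly_gt0 size_altsec.
have [s0] := hyperbolic_split N0 hyp; rewrite lead_coef_altsec // => NE0.
pose s := sort (fun x y => y <= x) s0.
have NE : altsec a k.+1 = a k.+1 *: \prod_(v <- s) ('X - v%:P).
  by rewrite NE0; congr (_ *: _); apply: perm_big; rewrite perm_sym perm_sort.
have ss : size s = k.+1.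
  have := size_altsec _ _ ak0; rewrite NE size_scale // size_prod_XsubC.
  by move=> [].
have srt : sorted (fun x y => y <= x) s.
  by apply: sort_sorted => x y; rewrite le_total.
have s_gt0 : {in s, forall v, 0 < v}.
  move=> v vs; rewrite ltNge; apply/negP => v0.
  have := altsec_neg a k.+1 v a0 v0.
  by rewrite NE hornerZ (rootP _) ?mulr0 ?ltxx // root_prod_XsubC.
have sum_s : a k = a k.+1 * \sum_(v <- s) v.
  have := coef_altsec_pred a k; rewrite NE coefZ.
  have := @coefPn_prod_XsubC R s; rewrite ss => /(_ isT) /= -> /eqP.
  by rewrite mulrN eqr_opp => /eqP.
case E: s ss => [|V r] // [sr].
have V0 : 0 < V by rewrite s_gt0 // E mem_head.
have rV : {in r, forall v, v <= V}.
  move: srt; rewrite E /= => /(order_path_min _).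
  move=> /(_ ltac:(by move=> x y z xy yz; exact: le_trans yz xy)).
  by move/allP.
have r0 : {in r, forall v, 0 < v} by move=> v vr; rewrite s_gt0 // E inE vr orbT.
have VE : (altsec a k.+1).[V] = 0.
  by rewrite NE E hornerZ (rootP _) ?mulr0 // root_prod_XsubC mem_head.
have lt_all x : V < x -> {in s, forall v, v < x}.
  move=> Vx v; rewrite E inE => /orP[/eqP->//|/rV vV]; exact: le_lt_trans vV Vx.
have hpos x : V < x -> 0 < (altsec a k.+1).[x].
  by move=> Vx; rewrite NE hornerZ mulr_gt0 // prod_XsubC_gt0 //; exact: lt_all.
have hdpos x : V < x -> 0 < (altsec a k.+1)^`().[x].
  move=> /lt_all; rewrite NE E => h.
  by rewrite derivZ hornerZ mulr_gt0 // deriv_prod_XsubC_gt0.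
have sum_ge0 : 0 <= \sum_(v <- r) v by rewrite big_seq sumr_ge0 // => v /r0 /ltW.
have lb : a k.+1 * V <= a k.
  by rewrite sum_s E big_cons ler_pM2l // lerDl.
have ub : a k <= k.+1%:R * (a k.+1 * V).
  rewrite sum_s mulrCA ler_pM2l // E big_cons -sr -[(size r).+1]add1n natrD mulrDl mul1r.
  have -> : (size r)%:R * V = \sum_(v <- r) V.
    by rewrite big_const_seq count_predT iter_addr_0 mulr_natl.
  by rewrite lerD2l big_seq [leRHS]big_seq; apply: ler_sum => v /rV.
have [k1|k1] := ltnP k 1.
  by exists V, V; split => //; rewrite ltnS leqNgt k1.
case: r E sr rV r0 sum_ge0 srt => [|w r] E sr rV r0 sum_ge0 srt; first by rewrite -sr in k1.
exists V, w.
have w0 : 0 < w by rewrite r0 ?mem_head.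
have wV : w <= V by rewrite rV ?mem_head.
have rw : {in r, forall v, v <= w}.
  move: srt; rewrite E /= => /andP[_] /(order_path_min _).
  move=> /(_ ltac:(by move=> x y z xy yz; exact: le_trans yz xy)) /allP; exact.
have r0' : {in r, forall v, 0 < v} by move=> v vr; rewrite r0 // inE vr orbT.
have NE' : altsec a k.+1 =
    a k.+1 *: (('X - V%:P) * (('X - w%:P) * \prod_(v <- r) ('X - v%:P))).
  by rewrite NE E !big_cons.
split => // _.
- by rewrite NE E hornerZ (rootP _) ?mulr0 // root_prod_XsubC !inE eqxx orbT.
- rewrite NE' derivZ !derivM !derivXsubC hornerZ.
  rewrite !(hornerM, hornerD, hornerN, hornerX, hornerC) subrr.
  rewrite !mul0r !mul1r add0r addr0 pmulr_rle0 //.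
  by rewrite mulr_le0_ge0 ?subr_le0 // prod_XsubC_ge0.
- rewrite mulrCA sum_s ler_pM2l // E !big_cons addrA.
  have : 0 <= \sum_(v <- r) v by rewrite big_seq sumr_ge0 // => v /r0' /ltW.
  lra.
- move=> x wx; have x0 : 0 < x := lt_le_trans w0 wx.
  rewrite NE' hornerZ ltr_pM2l // hornerM hornerXsubC.
  have Q0 : 0 <= (('X - w%:P) * \prod_(v <- r) ('X - v%:P)).[x].
    rewrite hornerM hornerXsubC mulr_ge0 ?subr_ge0 // prod_XsubC_ge0 // => v /rw vw.
    exact: le_trans vw wx.
  have Q1 : (('X - w%:P) * \prod_(v <- r) ('X - v%:P)).[x] <= x ^+ k.
    have := @prod_XsubC_le_exp R (w :: r) x; rewrite sr big_cons; apply => v.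
    rewrite inE => /orP[/eqP->|vr]; first by rewrite ltW.
    by rewrite ltW ?r0' //= (le_trans (rw v vr)).
  have xk : 0 < x ^+ k by rewrite exprn_gt0.
  rewrite exprS; move: Q0 Q1 xk; move: (_.[x]) (x ^+ k) => q y.
  rewrite mulrBl -subr_gt0 opprB addrA addrAC -mulrBr => q0 qy y0.
  have [->|qn0] := eqVneq q 0; first by rewrite subr0 mulr0 addr0 mulr_gt0.
  by rewrite ltr_wpDl ?mulr_ge0 ?subr_ge0 ?(ltW x0) // mulr_gt0 // lt0r qn0.
Qed.

(** * Raising the degree *)

Section Interlacing.
Context {R : realType} {a V w : nat -> R} {n : nat}.
Hypotheses (a_gt0 : forall k, (k <= n)%N -> 0 < a k)
  (tr : forall k, (1 <= k <= n)%N -> top_roots a k (V k) (w k)).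

(** The largest root of a section lies below the two largest roots of the next one:
    from [w k.+1] on, the next section stays below its leading term. *)
Lemma top_V_lt_w k : (1 <= k < n)%N -> V k < w k.+1.
Proof.
move=> kn; have [|_ _ Vk _ _ _ _ _ _ _ _] := tr k; first lia.
have [|_ _ _ _ _ _ _ _ _ _ lt1] := tr k.+1; first lia.
rewrite ltNge; apply/negP => /lt1 => /(_ ltac:(lia)).
by rewrite horner_altsecS Vk subr0 ltxx.
Qed.

Lemma top_w_lt k : (1 <= k < n)%N -> w k < w k.+1.
Proof.
move=> kn; apply: le_lt_trans (top_V_lt_w _ kn).
by apply: top_w_le (tr k _); lia.
Qed.

End Interlacing.

(** Coefficients of [X p_{i+1} + eps p_i' + delta X^(i+2)], where [p_k] is the section of
    degree [k] of [\sum_j a j *: 'X^j]. *)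
Definition raised {R : realType} (a : nat -> R) (i : nat) (eps delta : R) (j : nat) : R :=
  (if (0 < j)%N then a j.-1 else 0) + (if (j < i)%N then eps * (j.+1%:R * a j.+1) else 0)
  + (if j == i.+2 then delta else 0).

Section Improvement.
Context {R : realType} {a : nat -> R} {i : nat}.
Hypotheses (i_gt0 : (1 <= i)%N) (a_gt0 : forall k, (k <= i.+1)%N -> 0 < a k).

Lemma raised0 eps delta : raised a i eps delta 0 = eps * a 1%N.
Proof. by rewrite /raised i_gt0 /= mul1r add0r addr0. Qed.

Lemma raised_lt eps delta j : (j.+1 < i)%N ->
  raised a i eps delta j.+1 = a j + eps * (j.+2%:R * a j.+2).
Proof.
move=> ji; have h : (j.+1 == i.+2) = false by apply/negbTE; lia.
by rewrite /raised ji h /= addr0.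
Qed.

Lemma raised_i eps delta : raised a i eps delta i = a i.-1.
Proof.
have h : (i == i.+2) = false by apply/negbTE; lia.
by rewrite /raised i_gt0 ltnn h !addr0.
Qed.

Lemma raised_iS eps delta : raised a i eps delta i.+1 = a i.
Proof.
have h : (i.+1 == i.+2) = false by apply/negbTE; lia.
have h' : (i.+1 < i)%N = false by apply/negbTE; lia.
by rewrite /raised h h' !addr0.
Qed.

Lemma raised_iSS eps delta : raised a i eps delta i.+2 = a i.+1 + delta.
Proof.
have h' : (i.+2 < i)%N = false by apply/negbTE; lia.
by rewrite /raised eqxx h' addr0.
Qed.

Lemma raised_gt0 eps delta j :
  0 < eps -> 0 <= delta -> (j <= i.+2)%N -> 0 < raised a i eps delta j.
Proof.
move=> e0 d0; rewrite leq_eqVlt => /orP[/eqP->|].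
  by rewrite raised_iSS ltr_pwDl ?a_gt0.
rewrite ltnS leq_eqVlt => /orP[/eqP->|]; first by rewrite raised_iS a_gt0.
rewrite ltnS leq_eqVlt => /orP[/eqP->|]; first by rewrite raised_i a_gt0 //; lia.
case: j => [|j] ji; first by rewrite raised0 mulr_gt0 ?a_gt0.
by rewrite raised_lt // addr_gt0 ?mulr_gt0 ?a_gt0 //; lia.
Qed.

Lemma altsec_raised_lt eps delta k x : (k.+1 < i)%N ->
  (altsec (raised a i eps delta) k.+1).[x] =
  x * (altsec a k).[x] + eps * (altsec a k.+2)^`().[x].
Proof.
elim: k => [|k IH] ki.
  rewrite !(horner_altsecS, deriv_altsecS) raised_lt //= derivC !hornerC raised0.
  ring.
rewrite horner_altsecS raised_lt // IH; last lia.
rewrite (horner_altsecS a) (deriv_altsecS a k.+2) !exprS; ring.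
Qed.

Lemma altsec_raised_i eps delta x :
  (altsec (raised a i eps delta) i).[x] = x * (altsec a i.-1).[x] - eps * (altsec a i)^`().[x].
Proof.
suff H k : i = k.+1 -> (altsec (raised a i eps delta) k.+1).[x] =
    x * (altsec a k).[x] - eps * (altsec a k.+1)^`().[x].
  by have := H i.-1; rewrite (prednK i_gt0) => /(_ erefl).
move=> iE; have r : raised a i eps delta k.+1 = a k.
  by rewrite -[in LHS]iE raised_i iE.
rewrite horner_altsecS r; case: k iE {r} => [|k] iE.
  by rewrite deriv_altsecS /= derivC !hornerC raised0; ring.
rewrite altsec_raised_lt; last by rewrite iE.
by rewrite (horner_altsecS a) !exprS; ring.
Qed.

Lemma altsec_raised_iS eps delta x :
  (altsec (raised a i eps delta) i.+1).[x] = x * (altsec a i).[x] + eps * (altsec a i)^`().[x].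
Proof.
have Ni : (altsec a i).[x] = a i * x ^+ i - (altsec a i.-1).[x].
  by rewrite -[in LHS](prednK i_gt0) horner_altsecS prednK.
by rewrite horner_altsecS altsec_raised_i raised_iS Ni exprS; ring.
Qed.

Lemma altsec_raised_iSS eps delta x :
  (altsec (raised a i eps delta) i.+2).[x] =
  x * (altsec a i.+1).[x] - eps * (altsec a i)^`().[x] + delta * x ^+ i.+2.
Proof.
rewrite horner_altsecS altsec_raised_iS raised_iSS (horner_altsecS a) !exprS.
ring.
Qed.

(** Raising the degree by one while shifting the coefficients of degrees [i.-1], [i] by
    one and strictly increasing the next one.  The points certifying the new section
    of degree [k.+1], [2 <= k], are the second largest roots [w k] of the old one of
    degree [k], where the derivative of the latter is nonpositive. *)
Lemma improvement : (forall k, (1 <= k <= i.+1)%N -> hyperbolic (altsec a k)) ->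
  exists b u : nat -> R, [/\ (forall k, (k <= i.+2)%N -> 0 < b k), chain b u i.+2,
    b i = a i.-1, b i.+1 = a i & a i.+1 < b i.+2].
Proof.
move=> hyp.
have /choice[Vw trV] : forall k, exists y : R * R, (1 <= k <= i.+1)%N ->
    top_roots a k y.1 y.2.
  move=> k.
  have [kn|nk] := boolP (1 <= k <= i.+1)%N; last by exists (0, 0).
  have [|j jk|V [w h]] := altsec_top_roots a k _ _ (hyp k kn); first nlia.
  - by apply: a_gt0; nlia.
  - by exists (V, w).
pose V k := (Vw k).1; pose w k := (Vw k).2.
have {trV} tr k : (1 <= k <= i.+1)%N -> top_roots a k (V k) (w k) by exact: trV.
have w0 k : (1 <= k <= i.+1)%N -> 0 < w k by move=> kn; exact: top_w_gt0 (tr k kn).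
have wS k : (1 <= k < i.+1)%N -> w k < w k.+1 by exact: (top_w_lt tr).
have wr k : (2 <= k <= i.+1)%N -> (altsec a k).[w k] = 0.
  by move=> kn; apply: top_w_root (tr k _) _; nlia.
have wd k : (2 <= k <= i.+1)%N -> (altsec a k)^`().[w k] <= 0.
  by move=> kn; apply: top_w_deriv (tr k _) _; nlia.
have w2 k : (2 <= k <= i.+1)%N -> 2 * (a k * w k) <= a k.-1.
  by move=> kn; apply: top_w_lb (tr k _) _; nlia.
have aw k : (2 <= k <= i.+1)%N -> a k * w k <= a k.-1.
  move=> kn; apply: le_trans (w2 k kn); rewrite mulr_natl mulr2n lerDl ltW //.
  by rewrite mulr_gt0 ?w0 ?a_gt0 //; nlia.
(* Makes the derivative of the section of degree [k.+2] nonpositive at [w k]. *)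
have wa k : (2 <= k)%N -> (k.+1 < i)%N -> k.+2%:R * (a k.+2 * w k) <= k.+1%:R * a k.+1.
  move=> k2 ki; have := w2 k.+2 ltac:(nlia); rewrite /= => h.
  have ww : w k < w k.+2 by apply: lt_trans (wS k _) (wS k.+1 _); nlia.
  have ak1 : 0 < a k.+1 by apply: a_gt0; nlia.
  have ak2 : 0 < a k.+2 by apply: a_gt0; nlia.
  have h2 : a k.+2 * w k <= a k.+1 / 2.
    by rewrite ler_pdivlMr // mulrC (le_trans _ h) // ler_pM2l // ler_pM2l // ltW.
  apply: le_trans (ler_wpM2l (ler0n _ _) h2) _.
  by rewrite mulrCA mulrC ler_pM2r // ler_pdivrMr // -natrM ler_nat; nlia.
have a0 : 0 < a 0%N by apply: a_gt0; nlia.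
have a1 : 0 < a 1%N by apply: a_gt0; nlia.
have a2 : 0 < a 2%N by apply: a_gt0; nlia.
(* [eps] is small enough for the new sections of degrees [1] and [2]. *)
have [eps [e0 eB e2]] : exists eps, [/\ 0 < eps,
    4 * (eps * a 1%N) * (a 1%N + eps * (3 * `|a 3%N|)) <= a 0%N ^+ 2
    & eps * (2 * a 2%N) <= a 0%N].
  pose B := a 1%N + 3 * `|a 3%N|.
  have Ba1 : a 1%N <= B by rewrite /B lerDl mulr_ge0.
  have B0 : 0 < B by apply: lt_le_trans Ba1.
  pose eps := Num.min 1 (Num.min (a 0%N ^+ 2 / (4 * a 1%N * B)) (a 0%N / (2 * a 2%N))).
  have e0 : 0 < eps by rewrite /eps !lt_min ltr01 !divr_gt0 ?exprn_gt0 ?mulr_gt0.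
  have e1 : eps <= 1 by rewrite /eps ge_min lexx.
  exists eps; split => //.
    apply: le_trans (_ : eps * (4 * a 1%N * B) <= _).
      have -> : eps * (4 * a 1%N * B) = 4 * (eps * a 1%N) * B by ring.
      rewrite ler_pM2l ?mulr_gt0 // lerD2l.
      by rewrite mulrCA ler_pM2l // ler_piMl.
    by rewrite -ler_pdivlMr ?mulr_gt0 // /eps !ge_min lexx !orbT.
  by rewrite -ler_pdivlMr ?mulr_gt0 // /eps !ge_min lexx !orbT.
have wt0 : 0 < w i.+1 by apply: w0; nlia.
(* The strict inequality at the top section leaves room for [delta]. *)
have [delta [delta0 deltaa deltad]] : exists delta, [/\ 0 < delta, delta <= a i.+1
    & delta * w i.+1 ^+ i.+2 <= eps * (altsec a i)^`().[w i.+1]].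
  have d0 : 0 < eps * (altsec a i)^`().[w i.+1].
    rewrite mulr_gt0 // (top_deriv_gt0 _ _ _ _ (tr i _)) //; first nlia.
    by apply: (top_V_lt_w tr); nlia.
  exists (Num.min (a i.+1) (eps * (altsec a i)^`().[w i.+1] / w i.+1 ^+ i.+2)); split.
  - by rewrite lt_min a_gt0 //= divr_gt0 // exprn_gt0.
  - by rewrite ge_min lexx.
  - by rewrite -ler_pdivlMr ?exprn_gt0 // ge_min lexx orbT.
have [b bE] : exists b, b = raised a i eps delta by exists (raised a i eps delta).
have b_gt0 k : (k <= i.+2)%N -> 0 < b k by rewrite bE; apply: raised_gt0 => //; exact: ltW.
(* Hence the last condition in the certificate, as no point [u k.+1] exceeds [w k.+1]. *)
have bw k : (2 <= k <= i.+1)%N -> b k.+1 * w k <= b k.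
  case/andP=> k2; rewrite leq_eqVlt => /orP[/eqP kE|].
    rewrite kE bE raised_iSS raised_iS.
    have wi : 0 < w i.+1 by [].
    have dw : delta * w i.+1 <= a i.+1 * w i.+1 by rewrite ler_pM2r.
    have ii : (1 < i.+1 <= i.+1)%N by rewrite ltnS i_gt0 leqnn.
    have := w2 i.+1 ii.
    rewrite mulr_natl mulr2n mulrDl.
    apply: le_trans.
    by rewrite lerD2l.
  rewrite ltnS leq_eqVlt => /orP[/eqP kE|ki].
    rewrite {1 3}kE bE raised_iS raised_i -kE.
    by rewrite aw //; nlia.
  have -> : b k = a k.-1 + eps * (k.+1%:R * a k.+1).
    by case: k k2 ki => // k k2 ki; rewrite bE raised_lt.
  have ak : a k * w k <= a k.-1 by apply: aw; nlia.
  have [ki2|ki2] := ltnP k.+1 i; last first.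
    have kE : k.+1 = i by nlia.
    rewrite [in b _]kE bE raised_i -kE /= (le_trans ak) // lerDl !mulr_ge0 //; try exact: ltW.
    by rewrite ltW ?a_gt0; nlia.
  by rewrite bE raised_lt // mulrDl lerD // -mulrA ler_pM2l // -mulrA wa.
have b_0 : b 0%N = eps * a 1%N by rewrite bE raised0.
have [b1_lb b1_ub] : a 0%N <= b 1%N /\ b 1%N <= 2 * a 0%N.
  have [i1|i1] := ltnP 1 i.
    rewrite bE raised_lt // lerDl [2 * a 0%N]mulr_natl (mulr2n (a 0%N)) lerD2l.
    by split=> //; rewrite !mulr_ge0 ?ler0n // ltW.
  have iE : i = 1%N by nlia.
  have -> : b 1%N = a 0%N by rewrite bE -[in LHS]iE raised_i iE.
  by rewrite lexx mulr_natl (mulr2n (a 0%N)) lerDl ltW.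
have [b2_lb b2_ub] : a 1%N <= b 2%N /\ b 2%N <= a 1%N + eps * (3 * `|a 3%N|).
  have e3 : 0 <= eps * (3 * `|a 3%N|) by rewrite !mulr_ge0 // ltW.
  have [i2|i2] := ltnP 2 i.
    have a3 : 0 < a 3%N by apply: a_gt0; nlia.
    rewrite bE raised_lt // lerDl lerD2l gtr0_norm //.
    by split=> //; rewrite !mulr_ge0 ?ler0n // ltW.
  have -> : b 2%N = a 1%N; last by rewrite lerDl.
  have [iE|iE] : i = 1%N \/ i = 2%N by nlia.
    by rewrite bE -[in LHS]iE raised_iS iE.
  by rewrite bE -[in LHS]iE raised_i iE.
have b0_gt0 : 0 < b 0%N by apply: b_gt0.
have b1_gt0 : 0 < b 1%N by apply: b_gt0.
have b2_gt0 : 0 < b 2%N by apply: b_gt0.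
have disc : 4 * b 0%N * b 2%N <= b 1%N ^+ 2.
  apply: le_trans (_ : a 0%N ^+ 2 <= _); last first.
    by rewrite lerXn2r // nnegrE ltW.
  by apply: le_trans eB; rewrite b_0 ler_pM2l ?mulr_gt0.
have b12 : b 1%N <= 2 * (b 2%N * w 2%N).
  apply: le_trans b1_ub _; rewrite ler_pM2l //.
  have V1 : a 0%N <= a 1%N * V 1%N by have := top_ub _ _ _ _ (tr 1%N isT); rewrite mul1r.
  have V1w : V 1%N < w 2%N by apply: (top_V_lt_w tr); nlia.
  have V1_gt0 : 0 < V 1%N.
    by apply: lt_le_trans (top_w_gt0 _ _ _ _ (tr 1%N isT)) (top_w_le _ _ _ _ (tr 1%N isT)).
  by apply: le_trans V1 _; apply: ler_pM (ltW a1) (ltW V1_gt0) b2_lb (ltW V1w).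
(* The root of the new section of degree [1], the minimizer of the one of degree [2],
   and then the points [w 2], [w 3], and so on. *)
pose u k := if k is k'.+1 then
   if k' == 0%N then b 0%N / b 1%N else if k' == 1%N then b 1%N / (2 * b 2%N) else w k' else 0.
have u1 : u 1%N = b 0%N / b 1%N by [].
have u2 : u 2%N = b 1%N / (2 * b 2%N) by [].
have uw k : (2 <= k)%N -> u k.+1 = w k by case: k => [|[|k]].
have u2w : u 2%N <= w 2%N.
  by rewrite u2 ler_pdivrMr ?mulr_gt0 // mulrC -mulrA.
have uwle k : (1 <= k <= i)%N -> u k.+1 <= w k.+1.
  case: k => // -[|k] ki; first exact: u2w.
  by rewrite uw // ltW // wS //; nlia.
have bi : b i = a i.-1 by rewrite bE raised_i.
have biS : b i.+1 = a i by rewrite bE raised_iS.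
have biSS : b i.+2 = a i.+1 + delta by rewrite bE raised_iSS.
exists b, u; split => //; last by rewrite biSS ltrDl.
split.
- by rewrite u1 divr_gt0.
- case=> // -[|k] ki; last by rewrite (uw k.+2) // uwle; nlia.
  rewrite u1 u2 ler_pdivrMr // mulrAC ler_pdivlMr ?mulr_gt0 //.
  have h : 0 <= b 0%N * b 2%N by rewrite mulr_ge0 // ltW.
  move: disc h; rewrite -expr2 -mulrA [b 0%N * (_ * _)]mulrCA.
  by move: (b 0%N * b 2%N) (b 1%N ^+ 2) => x y; lra.
- case=> // -[|[|k]] ki.
  + by rewrite u1 horner_altsecS hornerC expr1 mulrCA mulfV ?gt_eqF // mulr1 subrr.
  + rewrite u2 !horner_altsecS hornerC expr1.
    have b2n0 : b 2%N != 0 by rewrite gt_eqF.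
    have -> : b 2%N * (b 1%N / (2 * b 2%N)) ^+ 2 - (b 1%N * (b 1%N / (2 * b 2%N)) - b 0%N)
        = (4 * b 0%N * b 2%N - b 1%N ^+ 2) / (4 * b 2%N) by field.
    by rewrite pmulr_lle0 ?invr_gt0 ?mulr_gt0 // subr_le0.
  rewrite uw //; have wk : 0 < w k.+2 by apply: w0; nlia.
  have [kE|[kE|[kE|ki2]]] :
    k.+2 = i.+1 \/ k.+2 = i \/ k.+3 = i \/ (k.+3 < i)%N by nlia.
  + rewrite kE bE altsec_raised_iSS wr ?mulr0; last nlia.
    by rewrite sub0r addrC subr_le0.
  + rewrite kE bE altsec_raised_iS wr ?mulr0 ?add0r; last nlia.
    by rewrite pmulr_rle0 // wd //; nlia.
  + have := altsec_raised_i eps delta (w k.+2); rewrite -bE -[in X in X -> _]kE => ->.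
    rewrite wr ?mulr0; last nlia.
    rewrite sub0r oppr_le0 mulr_ge0 ?(ltW e0) // deriv_altsecS subr_ge0.
    apply: le_trans (wd k.+2 _) _; first nlia.
    have ak : 0 < a k.+3 by apply: a_gt0; nlia.
    by rewrite mulr_ge0 ?exprn_ge0 ?(ltW wk) // mulr_ge0 ?ler0n // ltW.
  rewrite bE altsec_raised_lt // wr ?mulr0 ?add0r; last nlia.
  rewrite pmulr_rle0 // deriv_altsecS (deriv_altsecS a k.+2).
  have d2 : (altsec a k.+2)^`().[w k.+2] <= 0 by apply: wd; nlia.
  rewrite subr_le0; apply: le_trans (_ : k.+3%:R * a k.+3 * w k.+2 ^+ k.+2 <= _).
    by rewrite exprS mulrA ler_pM2r ?exprn_gt0 // -mulrA wa.
  by rewrite lerBrDr gerDl.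
- case=> // -[|k] ki.
    rewrite u1 mulrA ler_pdivrMr // -expr2; apply: le_trans disc.
    rewrite [leLHS]mulrC ler_pM2r // ler_peMl ?ler1n // ltW //.
  apply: le_trans (_ : b k.+3 * w k.+2 <= _); last by apply: bw; nlia.
  by rewrite ler_pM2l ?b_gt0 ?uwle //; nlia.
Qed.

End Improvement.

(** * Normalized sections *)

(** Sequences whose first [n.+1] terms are positive and are the coefficients of a
    section-hyperbolic polynomial of degree [n]. *)
Definition admissible {R : realType} (a : nat -> R) (n : nat) : Prop :=
  (forall k, (k <= n)%N -> 0 < a k) /\
  (forall k, (1 <= k <= n)%N -> hyperbolic (altsec a k)).

(** The inverses of the ratios [a_i^2 / (a_{i-1} a_{i+1})]. *)
Definition invratio {R : realType} (a : nat -> R) (i : nat) : R :=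
  a i.-1 * a i.+1 / a i ^+ 2.

(** Sections in normalized form, as functions of the inverse ratios: if [N_k] is the
    alternating section of degree [k] of [a], then [N_k(x)] is the product of [a k * x ^+ k]
    and of [nsec (invratio a) k y], where [y = a k.-1 / (a k * x)]. *)
Fixpoint nsec {R : realType} (rho : nat -> R) (k : nat) (y : R) : R :=
  if k is k'.+1 then 1 - y * nsec rho k' (rho k' * y) else 1.

(** The normalized form of [chain], which makes sense for inverse ratios equal to [0]. *)
Definition nchain {R : realType} (rho y : nat -> R) (n : nat) : Prop :=
  [/\ forall k, (1 <= k <= n)%N -> nsec rho k (y k) <= 0,
      forall k, (1 <= k < n)%N -> rho k * y k.+1 <= y k
    & forall k, (1 <= k < n)%N -> rho k <= y k].

Section Normalized.
Context {R : realType}.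
Implicit Types (a rho y u : nat -> R) (k n i : nat) (x : R).

Lemma nsecS rho k x : nsec rho k.+1 x = 1 - x * nsec rho k (rho k * x).
Proof. by []. Qed.

Lemma nsec0 rho k : nsec rho k 0 = 1.
Proof. by case: k => //= k; rewrite mul0r subr0. Qed.

Lemma eq_nsec rho rho' k x : (forall j, (1 <= j < k)%N -> rho j = rho' j) ->
  nsec rho k x = nsec rho' k x.
Proof.
elim: k x => // k IH x h; case: k IH h => // k IH h.
rewrite !(nsecS _ k.+1) (h k.+1) ?ltnSn // IH // => j /andP[j1 jk].
by rewrite h // j1 ltnW.
Qed.

(** A vanishing inverse ratio decouples the coefficients beyond it from the others. *)
Lemma nsec_shift rho j l x : rho j = 0 ->
  nsec rho (j + l.+1) x = nsec (fun k => rho (j + k)%N) l.+1 x.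
Proof.
move=> rj; elim: l x => [|l IH] x.
  by rewrite addn1 nsecS rj mul0r nsec0 /=.
by rewrite addnS nsecS IH [RHS]nsecS.
Qed.

Lemma horner_altsec_nsec a k x : (forall j, (j <= k)%N -> a j != 0) -> x != 0 ->
  (altsec a k).[x] = a k * x ^+ k * nsec (invratio a) k (a k.-1 / (a k * x)).
Proof.
move=> a0 x0; elim: k a0 => [|k IH] a0; first by rewrite hornerC !mulr1.
have ak : a k != 0 by apply: a0.
have ak1 : a k.+1 != 0 by apply: a0.
rewrite horner_altsecS IH => [|j jk]; last by apply: a0; apply: leqW.
rewrite /= mulrBr mulr1; congr (_ - _).
rewrite !mulrA; congr (_ * _); first by rewrite exprS; field; rewrite ak1 x0.
case: k {IH a0} ak ak1 => // k ak ak1; congr nsec.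
by rewrite /invratio /=; field; rewrite ak ak1 x0.
Qed.

Lemma admissible_nchain a n : admissible a n ->
  exists y, nchain (invratio a) y n /\ forall k, (1 <= k <= n)%N -> 0 <= y k <= n%:R.
Proof.
case=> a_gt0 hyp.
have /choice[V trV] : forall k, exists V, (1 <= k <= n)%N -> exists w, top_roots a k V w.
  move=> k; have [kn|nk] := boolP (1 <= k <= n)%N; last by exists 0.
  have [|j jk|V [w h]] := altsec_top_roots a k _ _ (hyp k kn); first nlia.
  - by apply: a_gt0; nlia.
  - by exists V => _; exists w.
have V_gt0 k : (1 <= k <= n)%N -> 0 < V k.
  by move=> /trV[w tr]; apply: lt_le_trans (top_w_gt0 _ _ _ _ tr) (top_w_le _ _ _ _ tr).
have VS k : (1 <= k < n)%N -> V k <= V k.+1.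
  move=> kn; have [w tr] := trV k ltac:(nlia); have [w' tr'] := trV k.+1 ltac:(nlia).
  apply: le_trans (top_w_le _ _ _ _ tr'); rewrite leNgt; apply/negP => /ltW.
  move=> /(top_lt _ _ _ _ tr' ltac:(nlia)).
  by rewrite horner_altsecS (top_root _ _ _ _ tr) subr0 ltxx.
have V_lb k : (1 <= k <= n)%N -> a k * V k <= a k.-1 by move=> /trV[w]; exact: top_lb.
exists (fun k => a k.-1 / (a k * V k)); split; first split.
- move=> k kn; have [w tr] := trV k kn.
  have V0 := V_gt0 k kn; have ak : 0 < a k by apply: a_gt0; nlia.
  have : (altsec a k).[V k] = 0 by exact: top_root tr.
  rewrite horner_altsec_nsec ?gt_eqF // => [/eqP|j jk]; last by rewrite gt_eqF ?a_gt0; nlia.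
  by rewrite mulf_eq0 gt_eqF ?mulr_gt0 ?exprn_gt0 //= => /eqP->.
- move=> k kn; have V0 : 0 < V k by apply: V_gt0; nlia.
  have V1 : 0 < V k.+1 by apply: V_gt0; nlia.
  have ak : 0 < a k by apply: a_gt0; nlia.
  have ak1 : 0 < a k.+1 by apply: a_gt0; nlia.
  have ap : 0 < a k.-1 by apply: a_gt0; nlia.
  have -> : invratio a k * (a k.+1.-1 / (a k.+1 * V k.+1)) = a k.-1 / a k / V k.+1.
    by rewrite /invratio /=; field; rewrite !gt_eqF.
  by rewrite invfM mulrA ler_pM2l ?divr_gt0 // lef_pV2 ?posrE // VS.
- move=> k kn; have V0 : 0 < V k by apply: V_gt0; nlia.
  have ak : 0 < a k by apply: a_gt0; nlia.
  have ap : 0 < a k.-1 by apply: a_gt0; nlia.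
  have lb : a k.+1 * V k <= a k.
    apply: le_trans (V_lb k.+1 _); last nlia.
    by rewrite ler_pM2l ?VS ?a_gt0 //; nlia.
  rewrite /invratio -!mulrA ler_pM2l // -[leRHS]div1r ler_pdivlMr ?mulr_gt0 //.
  have -> : a k.+1 / a k ^+ 2 * (a k * V k) = a k.+1 * V k / a k.
    by field; rewrite gt_eqF.
  by rewrite ler_pdivrMr // mul1r.
- move=> k kn; have V0 := V_gt0 k kn; have ak : 0 < a k by apply: a_gt0; nlia.
  have ap : 0 < a k.-1 by apply: a_gt0; nlia.
  have aV : 0 < a k * V k by rewrite mulr_gt0.
  apply/andP; split; first by rewrite ltW // divr_gt0.
  rewrite ler_pdivrMr //.
  have [w tr] := trV k kn; apply: le_trans (top_ub _ _ _ _ tr) _.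
  by rewrite ler_pM2r ?mulr_gt0 // ler_nat; nlia.
Qed.

Lemma nchain_admissible rho y n : (1 <= n)%N -> nchain rho y n ->
  (forall k, (1 <= k < n)%N -> 0 < rho k) -> (forall k, (1 <= k <= n)%N -> 0 <= y k) ->
  exists2 a, admissible a n & forall k, (1 <= k < n)%N -> invratio a k = rho k.
Proof.
move=> n1 [neg yS acc] r0 y0'.
have y0 k : (1 <= k <= n)%N -> 0 < y k.
  move=> kn; rewrite lt0r y0' // andbT; apply/eqP => yk.
  by have := neg k kn; rewrite yk nsec0 ler10.
(* [s k] is the quotient of the coefficients of degrees [k.-1] and [k]. *)
pose r k := if (1 <= k < n)%N then rho k else 1.
have rE k : (1 <= k < n)%N -> r k = rho k by rewrite /r => ->.
have rgt0 k : 0 < r k by rewrite /r; case: ifP => // /r0.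
pose s k : R := \prod_(1 <= j < k) (r j)^-1.
have s_gt0 k : 0 < s k by apply: prodr_gt0 => j _; rewrite invr_gt0.
have sS k : (1 <= k)%N -> s k.+1 = s k / r k by move=> k1; rewrite /s big_nat_recr.
pose a k : R := \prod_(1 <= j < k.+1) (s j)^-1.
have a_gt0 k : 0 < a k by apply: prodr_gt0 => j _; rewrite invr_gt0.
have aS k : a k.+1 = a k / s k.+1 by rewrite /a big_nat_recr.
have ratE k : (1 <= k < n)%N -> invratio a k = rho k.
  move=> kn; rewrite -rE // /invratio aS; case: k kn => // k kn.
  rewrite sS // aS /=; field.
  by rewrite !gt_eqF.
exists a => //; split => // k kn; move: k kn.
apply: (@chain_hyperbolic _ a (fun k => s k / y k)) => //.
have u_gt0 k : (1 <= k <= n)%N -> 0 < s k / y k by move=> kn; rewrite divr_gt0 // y0.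
split.
- by apply: u_gt0; nlia.
- move=> k kn; have yk := y0 k ltac:(nlia); have yk1 := y0 k.+1 ltac:(nlia).
  rewrite sS; last nlia.
  rewrite -mulrA ler_pM2l // -invfM lef_pV2 ?posrE ?mulr_gt0 //.
  by rewrite rE // yS.
- move=> k kn; have uk := u_gt0 k kn; have yk := y0 k kn.
  rewrite horner_altsec_nsec ?gt_eqF // => [|j _]; last by rewrite gt_eqF.
  rewrite pmulr_rle0 ?mulr_gt0 ?exprn_gt0 //.
  have -> : a k.-1 / (a k * (s k / y k)) = y k.
    case: k kn uk yk => // k kn uk yk; rewrite aS /=; field.
    by rewrite !gt_eqF.
  rewrite (@eq_nsec _ rho) ?neg // => j jk; apply: ratE; nlia.
- move=> k kn; have yk := y0 k ltac:(nlia).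
  rewrite aS sS; last nlia.
  rewrite -mulrA ger_pMr //; have -> : (s k / r k)^-1 * (s k / y k) = r k / y k.
    by field; rewrite !gt_eqF.
  by rewrite ler_pdivrMr // mul1r rE // acc.
Qed.

End Normalized.

(** * Compactness of the normalized data *)

Section Optimum.
Context {R : realType}.
Implicit Types (rho : nat -> R) (k n i : nat) (x : R).
Local Open Scope classical_set_scope.

Lemma continuous_nsec (T : topologicalType) (rho : nat -> T -> R) (g : T -> R) k :
  (forall j, continuous (rho j)) -> continuous g ->
  continuous (fun t => nsec (fun j => rho j t) k (g t)).
Proof.
move=> rhoC; elim: k g => [|k IH] g gC t /=; first exact: cvg_cst.
apply: (@cvgB _ R^o); first exact: cvg_cst.
apply: (@cvgM R); first exact: gC.
by apply: (IH (fun t => rho k t * g t)) => {}t; apply: (@cvgM R); [exact: rhoC|exact: gC].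
Qed.

Local Notation space := (prod_topology (fun _ : bool * nat => R)).

Lemma closed_le_fun (T : topologicalType) (f g : T -> R) :
  continuous f -> continuous g -> closed [set t | f t <= g t].
Proof.
move=> fC gC.
have -> : [set t | f t <= g t] = (fun t => f t - g t) @^-1` [set x | x <= 0].
  by apply/seteqP; split => t /=; rewrite subr_le0.
apply: closed_comp; last exact: closed_le.
by move=> t _; apply: (@cvgB _ R^o); [exact: fC|exact: gC].
Qed.

(** The normalized data of length [n]: a function on [bool * nat] encodes the inverse
    ratios by its values at [(true, k)] and the points of [nchain] by those at
    [(false, k)]. *)
Definition nchains (n : nat) : set space :=
  [set f | nchain (fun k => f (true, k)) (fun k => f (false, k)) n].

Lemma closed_nchains n : closed (nchains n).
Proof.
have pC q : continuous (fun f : space => f q) by exact: proj_continuous.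
have -> : nchains n =
  (\bigcap_(k in [set k | (1 <= k <= n)%N])
     [set f : space | nsec (fun j => f (true, j)) k (f (false, k)) <= 0]) `&`
  (\bigcap_(k in [set k | (1 <= k < n)%N])
     [set f : space | f (true, k) * f (false, k.+1) <= f (false, k)]) `&`
  (\bigcap_(k in [set k | (1 <= k < n)%N])
     [set f : space | f (true, k) <= f (false, k)]).
  apply/seteqP; split => f; first by case=> h1 h2 h3; split; first split.
  by case=> -[h1 h2] h3; split.
apply: closedI; first apply: closedI; apply: closed_bigI => k _.
- apply: (@closed_le_fun space (fun f => nsec (fun j => f (true, j)) k (f (false, k)))
    (fun=> 0)); last exact: cst_continuous.
  apply: (@continuous_nsec space (fun j f => f (true, j)) (fun f => f (false, k)) k).
  + by move=> j; exact: pC.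
  + exact: pC.
- apply: (@closed_le_fun space (fun f => f (true, k) * f (false, k.+1))
    (fun f => f (false, k))); last exact: pC.
  move=> f; apply: (@cvgM R _ (nbhs f) _ (fun f : space => f (true, k))
    (fun f : space => f (false, k.+1))); exact: pC.
- by apply: (@closed_le_fun space (fun f => f (true, k)) (fun f => f (false, k))); exact: pC.
Qed.

(** An inverse ratio reaches its maximum on bounded normalized data. *)
Lemma nchains_max n i B : (exists2 f, nchains n f & forall q, 0 <= f q <= B) ->
  exists2 f : space, nchains n f /\ (forall q, 0 <= f q <= B) &
    forall g : space, nchains n g -> (forall q, 0 <= g q <= B) -> g (true, i) <= f (true, i).
Proof.
move=> [f0 cf0 bf0].
pose box : set space := [set f | forall q, [set x | 0 <= x <= B] (f q)].
have cbox : compact box.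
  apply: (@tychonoff _ (fun _ : bool * nat => R) (fun=> [set x | 0 <= x <= B])) => _.
  rewrite (_ : [set x | _] = `[0, B]%classic); first exact: segment_compact.
  by apply/seteqP; split => x /=; rewrite in_itv.
have cK : compact (box `&` nchains n) by apply: compact_closedI => //; exact: closed_nchains.
have [||f] := @compact_EVT_max _ R (fun f : space => f (true, i)) _ _ cK.
- by exists f0.
- by apply: continuous_subspaceT; exact: proj_continuous.
move=> /set_mem[fb fn] fmax; exists f => // g gn gb.
by apply: fmax; apply/mem_set.
Qed.

End Optimum.

(** * The infima *)

Section Infimum.
Context {R : realType}.
Implicit Types (a b : nat -> R) (p : {poly R}) (n i : nat).
Local Open Scope classical_set_scope.

Lemma invratio_gt0 a n i : admissible a n -> (1 <= i < n)%N -> 0 < invratio a i.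
Proof.
case=> a0 _ ii; have ap : 0 < a i.-1 by apply: a0; nlia.
have ai : 0 < a i by apply: a0; nlia.
have an : 0 < a i.+1 by apply: a0; nlia.
by rewrite divr_gt0 ?mulr_gt0 ?exprn_gt0.
Qed.

Lemma admissible_improve a i : (1 <= i)%N -> admissible a i.+1 ->
  exists2 b, admissible b i.+2 & invratio a i < invratio b i.+1.
Proof.
move=> i1 ad; have [a0 hyp] := ad.
have [b [u [b0 ch bi biS biSS]]] := improvement i1 a0 hyp.
exists b; first by split => // k; exact: (chain_hyperbolic b0 ch).
have ap : 0 < a i.-1 by apply: a0; nlia.
have ai : 0 < a i by apply: a0; nlia.
by rewrite /invratio /= bi biS ltr_pM2r ?invr_gt0 ?exprn_gt0 // ltr_pM2l.
Qed.

Lemma admissible_ex i : (1 <= i)%N -> exists a, admissible a i.+1.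
Proof.
elim: i => // -[_ _|i IH _]; last first.
  have [a ad] := IH isT; have [b bd _] := admissible_improve a i.+1 isT ad; by exists b.
(* The polynomial [(1 + X)^2], up to a change of scale. *)
have [||k|k|a ad _] := @nchain_admissible R (fun=> 1 / 4) (fun k => k%:R) 2; last by exists a.
- by [].
- split.
  + by move=> [|[|[|k]]] //= _; lra.
  + by move=> [|[|k]] //= _; lra.
  + by move=> [|[|k]] //= _; lra.
- by move=> _; lra.
- by rewrite ler0n.
Qed.

Lemma admissible_nchains a n : admissible a n -> exists f, [/\ nchains n f,
  forall q, 0 <= f q <= n%:R & forall k, (1 <= k < n)%N -> f (true, k) = invratio a k].
Proof.
move=> ad; have [y [[neg yS acc] yB]] := admissible_nchain _ _ ad.
pose f (q : bool * nat) : R := if q.1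
  then if (1 <= q.2 < n)%N then invratio a q.2 else 0
  else if (1 <= q.2 <= n)%N then y q.2 else 0.
have fT k : (1 <= k < n)%N -> f (true, k) = invratio a k by rewrite /f /= => ->.
have fF k : (1 <= k <= n)%N -> f (false, k) = y k by rewrite /f /= => ->.
exists f; split => //.
- split=> k kn /=.
  + rewrite fF // (@eq_nsec _ _ (invratio a)) ?neg // => j jk; apply: fT; nlia.
  + by rewrite fT // !fF ?yS //; nlia.
  + by rewrite fT // fF ?acc //; nlia.
- case=> -[] k; rewrite /f /=; case: ifP => kn; rewrite ?lexx ?ler0n //; last exact: yB.
  rewrite ltW ?(invratio_gt0 _ _ _ ad) //=; apply: le_trans (acc k kn) _.
  by have /andP[] := yB k ltac:(nlia).
Qed.

(** The largest inverse ratio over a compact set of normalized data is attained; if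
    some of the maximizing inverse ratios vanish, the coefficients below the last of
    them are discarded, which lowers the index from [i] to some [i']. *)
Lemma extremal_admissible i : (1 <= i)%N -> exists i' a,
  [/\ (1 <= i' <= i)%N, admissible a i'.+1 &
      forall b, admissible b i.+1 -> invratio b i <= invratio a i'].
Proof.
move=> i1; have [|f [fn fB] fmax] := @nchains_max R i.+1 i i.+1%:R.
  have [a ad] := admissible_ex i i1.
  by have [f [fn fB _]] := admissible_nchains _ _ ad; exists f.
have ub b : admissible b i.+1 -> invratio b i <= f (true, i).
  move=> bd; have [g [gn gB gE]] := admissible_nchains _ _ bd.
  by rewrite -gE ?fmax // i1 /=.
have fi : 0 < f (true, i).
  have [a ad] := admissible_ex i i1.
  by apply: lt_le_trans (ub _ ad); apply: invratio_gt0 ad _; rewrite i1 /=.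
(* [j] is the last index below [i] with a vanishing inverse ratio, or [0]. *)
pose P j := (j < i)%N && ((j == 0%N) || (f (true, j) == 0)).
have exP : exists j, P j by exists 0%N; rewrite /P i1.
have leP j : P j -> (j <= i)%N by case/andP => /ltnW.
have [j /andP[ji Pj] jmax] := ex_maxnP exP leP.
have rho_gt0 k : (j < k <= i)%N -> 0 < f (true, k).
  move=> /andP[jk]; rewrite leq_eqVlt => /orP[/eqP->//|ki].
  rewrite lt0r; have /andP[-> _] := fB (true, k); rewrite andbT.
  by apply: contraL jk => fk; rewrite -leqNgt jmax // /P ki fk orbT.
pose rho k := f (true, (j + k)%N); pose y k := f (false, (j + k)%N).
have [||k kn|k _|a ad aE] := @nchain_admissible R rho y (i - j).+1.
- by [].
- case: fn => neg yS acc; split=> k kn.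
  + case: k kn => // k kn.
    have := neg (j + k.+1)%N ltac:(nlia); rewrite -/(y k.+1).
    move: Pj => /orP[/eqP j0|/eqP fj]; last by rewrite nsec_shift.
    by rewrite /rho j0 add0n; congr (_ <= _).
  + by rewrite /rho /y addnS yS //; nlia.
  + by rewrite /rho /y acc //; nlia.
- by apply: rho_gt0; nlia.
- by rewrite /y; have /andP[] := fB (false, (j + k)%N).
exists (i - j)%N, a; split => //; first nlia.
move=> b bd; rewrite aE; last nlia.
by rewrite /rho subnKC ?ub // ltnW.
Qed.

Lemma admissible_Delta p i : Delta p -> (i.+1 < size p)%N -> admissible (nth 0 p) i.+1.
Proof.
case=> n /= n1 [sp p0 pos hyp] ip; split=> k kn.
  case: k kn => [|k] kn; first by rewrite p0.
  by apply: pos; move: (leq_trans ip sp); nlia.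
apply/hyperbolic_take_poly; apply: hyp; move: (leq_trans ip sp); nlia.
Qed.

Lemma admissible_poly a i : admissible a i.+1 -> exists p,
  [/\ Delta p, (i.+1 < size p)%N & (p`_i ^+ 2 / (p`_i.-1 * p`_i.+1)) = (invratio a i)^-1].
Proof.
move=> [a_gt0 hyp]; have a0 : 0 < a 0%N by apply: a_gt0.
have a00 := lt0r_neq0 a0.
pose p := (a 0%N)^-1 *: \poly_(j < i.+2) a j.
have pE j : (j < i.+2)%N -> p`_j = (a 0%N)^-1 * a j by move=> ji; rewrite coefZ coef_poly ji.
have sp : size p = i.+2.
  rewrite size_scale ?invr_neq0 // size_poly_eq // lt0r_neq0 // a_gt0 //.
exists p; split; last first.
- rewrite !pE; try nlia.
  have ap : 0 < a i.-1 by apply: a_gt0; nlia.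
  have ai : 0 < a i by apply: a_gt0; nlia.
  have an : 0 < a i.+1 by apply: a_gt0; nlia.
  by rewrite /invratio; field; rewrite !gt_eqF.
- by rewrite sp.
exists i.+1 => //=; split.
- by rewrite sp.
- by rewrite pE // mulVf.
- by move=> k kn; rewrite pE ?mulr_gt0 ?invr_gt0 ?a_gt0; nlia.
move=> k kn; rewrite take_polyZ hyperbolicZ ?invr_neq0 //.
apply/hyperbolic_take_poly; rewrite (@eq_altsec _ _ a) => [|j jk]; first exact: hyp.
by rewrite coef_poly ifT //; nlia.
Qed.

Lemma m_le a i : (1 <= i)%N -> admissible a i.+1 -> m R i <= (invratio a i)^-1.
Proof.
move=> i1 ad; have [p [pD sp <-]] := admissible_poly _ _ ad.
apply: ge_inf; last by exists p.
exists 0 => _ [q [qD sq] <-]; have [q0 _] := admissible_Delta _ _ qD sq.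
by rewrite divr_ge0 ?exprn_ge0 ?mulr_ge0 // ltW // q0; nlia.
Qed.

Lemma m_ge (c : R) i : (1 <= i)%N ->
  (forall a, admissible a i.+1 -> c <= (invratio a i)^-1) -> c <= m R i.
Proof.
move=> i1 lb; apply: lb_le_inf.
  have [a /admissible_poly[p [pD sp _]]] := admissible_ex i i1.
  by exists (p`_i ^+ 2 / (p`_i.-1 * p`_i.+1)), p.
move=> _ [q [qD sq] <-].
by have := lb _ (admissible_Delta _ _ qD sq); rewrite /invratio invf_div.
Qed.

Lemma m_nonincreasing i : (1 <= i)%N -> m R i.+1 <= m R i.
Proof.
move=> i1; apply: (m_ge _ _ i1) => a ad.
have [b bd lt] := admissible_improve _ _ i1 ad.
have ra : 0 < invratio a i by apply: invratio_gt0 ad _; rewrite i1 /=.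
apply: le_trans (m_le _ _ _ bd) _ => //.
by rewrite lef_pV2 ?posrE ?(ltW lt) // (lt_trans ra).
Qed.

Lemma m_nonincreasing_le i j : (1 <= i <= j)%N -> m R j <= m R i.
Proof.
case/andP=> i1; elim: j => [|j IH]; first nlia.
rewrite leq_eqVlt => /orP[/eqP->//|ij].
by apply: le_trans (m_nonincreasing _ _) (IH _); nlia.
Qed.

End Infimum.

Theorem theorem3 (R : realType) (i : nat) : (1 <= i)%N -> m R i.+1 < m R i.
Proof.
move=> i1; have [i' [a [/andP[i'1 i'i] ad amax]]] := @extremal_admissible R i i1.
have [b bd lt] := admissible_improve _ _ i'1 ad.
have ra : 0 < invratio a i' by apply: invratio_gt0 ad _; rewrite i'1 /=.
apply: le_lt_trans (m_nonincreasing_le i'.+1 i.+1 _) _; first by [].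
apply: le_lt_trans (m_le _ _ _ bd) _ => //.
apply: lt_le_trans (m_ge (invratio a i')^-1 _ i1 _) => [|c cd].
  by rewrite ltf_pV2 ?posrE // (lt_trans ra).
have rc : 0 < invratio c i by apply: invratio_gt0 cd _; rewrite i1 /=.
by rewrite lef_pV2 ?posrE // amax.
Qed.
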